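(* Let $C_k$ be a cycle on $k\ge 5$ vertices with any edge-ordering. Then $sat_m(n,C_k)=\Theta(n)$.
   Context: An edge-ordered graph is a finite simple graph together with a linear order on its edge set (usually given by an injective labeling $l:E\to\mathbb{N}$ or $l:E\to\mathbb{R}$). An edge-ordered graph $H$ contains $G$ (has a copy of $G$) if $G$ is isomorphic, by an isomorphism respecting the edge-order, to a subgraph of $H$ with the induced order; otherwise $H$ is $G$-free. $sat_m(n,G)$ is the minimum number of edges in a $G$-free edge-ordered graph $H$ on $n$ vertices such that adding to $H$ any missing edge, inserted at the beginning of the linear order (i.e. with a label smaller than all labels of $H$), creates a copy of $G$. Asymptotic notation is for $n\to\infty$ with the edge-ordered graph $G$ fixed. *)

(* Defs.v *)
From HB Require Import structures.
From mathcomp Require Import all_boot all_order all_algebra.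
From mathcomp Require Import all_classical all_reals all_analysis.

Set Implicit Arguments.
Unset Strict Implicit.
Unset Printing Implicit Defensive.

Import Order.TTheory GRing.Theory Num.Theory.
Import numFieldNormedType.Exports.

(* Only the restriction of edge_le to edges is meaningful. *)
Record eograph (V : finType) := EOGraph {
  edges : {set {set V}};
  edge_le : rel {set V};
  edge_card : {in edges, forall e : {set V}, #|e| = 2};
  edge_le_anti : {in edges &, antisymmetric edge_le};
  edge_le_trans : {in edges & &, transitive edge_le};
  edge_le_total : {in edges &, total edge_le}
}.

(* The map phi is an order-respecting isomorphism from G onto the subgraph of H
   with vertices phi(W) and edges phi(e), e \in edges G. *)
Definition is_copy (W V : finType) (G : eograph W) (H : eograph V)
    (phi : W -> V) : Prop :=
  [/\ injective phi,
      {in edges G, forall e : {set W}, phi @: e \in edges H} &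
      {in edges G &, forall e f : {set W},
        edge_le H (phi @: e) (phi @: f) = edge_le G e f}].

Definition contains (V W : finType) (H : eograph V) (G : eograph W) : Prop :=
  exists phi : W -> V, is_copy G H phi.

Definition missing_edge (V : finType) (H : eograph V) (e : {set V}) : Prop :=
  #|e| = 2 /\ e \notin edges H.

Section AddFirst.
Context {V : finType} (H : eograph V) (e : {set V}) (he : missing_edge H e).

Definition first_edges : {set {set V}} := e |: edges H.

Definition first_le : rel {set V} :=
  fun f g => (f == e) || ((g != e) && edge_le H f g).

Lemma first_edges_card : {in first_edges, forall f : {set V}, #|f| = 2}.
Proof.
by move=> f /setU1P[->|]; [case: he | exact: edge_card].
Qed.

Lemma first_le_anti : {in first_edges &, antisymmetric first_le}.
Proof.
move=> f g /setU1P fE /setU1P gE; rewrite /first_le.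
have [->|fe] := eqVneq f e; first by rewrite /= orbF => /eqP.
have [->|ge] := eqVneq g e; first by [].
case: fE gE => [/eqP|fE [/eqP|gE]]; rewrite ?(negPf fe) ?(negPf ge) //=.
exact: edge_le_anti.
Qed.

Lemma first_le_trans : {in first_edges & &, transitive first_le}.
Proof.
move=> g f h /setU1P gE /setU1P fE /setU1P hE; rewrite /first_le.
have [//|fe] := eqVneq f e; have [//|ge] := eqVneq g e.
have [//|he'] := eqVneq h e; rewrite /=.
case: gE => [/eqP|gE]; first by rewrite (negPf ge).
case: fE => [/eqP|fE]; first by rewrite (negPf fe).
case: hE => [/eqP|hE]; first by rewrite (negPf he').
exact: edge_le_trans.
Qed.

Lemma first_le_total : {in first_edges &, total first_le}.
Proof.
move=> f g /setU1P fE /setU1P gE; rewrite /first_le.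
have [//|fe] := eqVneq f e; have [//|ge] := eqVneq g e; rewrite /=.
case: gE => [/eqP|gE]; first by rewrite (negPf ge).
case: fE => [/eqP|fE]; first by rewrite (negPf fe).
exact: edge_le_total.
Qed.

Definition add_first : eograph V :=
  EOGraph first_edges_card first_le_anti first_le_trans first_le_total.

End AddFirst.

Definition m_saturated (V W : finType) (G : eograph W) (H : eograph V) : Prop :=
  ~ contains H G /\
  forall (e : {set V}) (he : missing_edge H e), contains (add_first he) G.

Definition m_saturated_size (n : nat) (W : finType) (G : eograph W) (m : nat)
    : Prop :=
  exists H : eograph 'I_n, m_saturated G H /\ #|edges H| = m.

(* The default 0 is used only if no saturated graph exists; this never happens
   when G has an edge, see sat_mP. *)
Definition sat_m (n : nat) (W : finType) (G : eograph W) : nat :=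
  match pselect (exists m, `[< m_saturated_size n G m >]) with
  | left ex => ex_minn ex
  | right _ => 0
  end.

Section SatM.
Context {W : finType} (G : eograph W) (hG : edges G != finset.set0).

Lemma m_saturated_exists (V : finType) : exists H : eograph V, m_saturated G H.
Proof.
suff main k (H : eograph V) : ~ contains H G ->
    #|{set V}| - #|edges H| <= k -> exists H' : eograph V, m_saturated G H'.
  have c0 : {in (finset.set0 : {set {set V}}), forall e : {set V}, #|e| = 2}.
    by move=> e; rewrite inE.
  have a0 : {in (finset.set0 : {set {set V}}) &,
                antisymmetric (fun _ _ : {set V} => true)}.
    by move=> e f; rewrite inE.
  have t0 : {in (finset.set0 : {set {set V}}) & &,
                transitive (fun _ _ : {set V} => true)}.
    by move=> e f g; rewrite inE.
  have l0 : {in (finset.set0 : {set {set V}}) &, total (fun _ _ : {set V} => true)}.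
    by move=> e f; rewrite inE.
  apply: (main _ (EOGraph c0 a0 t0 l0) _ (leqnn _)) => -[phi [_ hphi _]].
  by have /finset.set0Pn[e /hphi] := hG; rewrite inE.
elim: k H => [|k IH] H Hfree hk.
  exists H; split=> // e he; exfalso; have [_ eH] := he; move: hk.
  rewrite leqn0 subn_eq0 leqNgt => /negP; apply.
  rewrite -cardsT; apply/proper_card/properP; split; first exact: finset.subsetT.
  by exists e; rewrite ?finset.inE.
have [[e [he hfree]]|nex] := pselect (exists e (he : missing_edge H e),
    ~ contains (add_first he) G).
  apply: (IH _ hfree) => /=.
  rewrite cardsU1 (proj2 he) add1n subnS.
  by case: (_ - _) hk.
exists H; split=> // e he; apply: contrapT => hc; apply: nex.
by exists e, he.
Qed.

Lemma sat_mP (n : nat) :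
  m_saturated_size n G (sat_m n G) /\
  forall H : eograph 'I_n, m_saturated G H -> sat_m n G <= #|edges H|.
Proof.
rewrite /sat_m; case: pselect => [ex|nex].
  case: ex_minnP => m /asboolP hm hmin; split=> // H HG.
  by apply: hmin; apply/asboolP; exists H.
have [H HG] := m_saturated_exists 'I_n.
by case: nex; exists #|edges H|; apply/asboolP; exists H.
Qed.

End SatM.

Definition cycle_edges (k : nat) : {set {set 'I_k}} :=
  [set [set i; ordS i] | i : 'I_k].

(* Main.v *)
(** Lower bound: an edge added between two isolated vertices lies on no cycle, so
a saturated graph has at most one isolated vertex.

Upper bound: remove from C its smallest edge xy together with x and y, and join
both ends of the remaining path on k - 2 vertices (the core) to all other (outer)
vertices. The edges at one end inherit the rank in C of the edge leading to x,
the edges at the other end that of the edge leading to y. This graph contains no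
C, it has O(n) edges, and a new smallest edge between two outer vertices closes
the path to a copy of C. Hence greedy completion only ever adds edges that meet
the core, of which there are at most kn. *)
Require Import Defs.
From mathcomp Require Import all_boot all_order all_algebra.
From mathcomp Require Import all_classical all_reals all_analysis.
From mathcomp Require Import zify.
Import Order.TTheory GRing.Theory Num.Theory.
Import numFieldNormedType.Exports.

Set Implicit Arguments.
Unset Strict Implicit.
Unset Printing Implicit Defensive.

(** * Pairs and the cyclic successor *)

Lemma imset_set2 (aT rT : finType) (f : aT -> rT) (a b : aT) :
  f @: [set a; b] = [set f a; f b].
Proof. by rewrite imsetU1 imset_set1. Qed.

Lemma val_iter_ordS (k m : nat) (i : 'I_k) :
  iter m (@ordS k) i = (i + m) %% k :> nat.
Proof.
elim: m => [|m IH] /=; first by rewrite addn0 modn_small.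
by rewrite IH -addn1 modnDml addn1 addnS.
Qed.

Lemma iter_ordS_neq (k m : nat) (i : 'I_k) :
  0 < m < k -> (iter m (@ordS k) i == i) = false.
Proof.
case/andP=> m0 mk; apply/negP => /eqP /(congr1 val) /=.
rewrite val_iter_ordS -[RHS](modn_small (ltn_ord i)) -[in RHS](addn0 i).
move=> /eqP; rewrite eqn_modDl mod0n modn_small // => /eqP m00.
by rewrite m00 in m0.
Qed.

(** * Edge orders from keys, ranks of edges, greedy completion *)

Section KeyOrder.
Context {V : finType} (E : {set {set V}}).
Context (E2 : {in E, forall e : {set V}, #|e| = 2}) (key : {set V} -> nat).

(** Ties between equal keys are broken by [enum_rank]: the keys used below are shared by many edges,
    and the order must stay antisymmetric. *)
Definition key_le : rel {set V} := fun e f =>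
  (key e < key f) || ((key e == key f) && (enum_rank e <= enum_rank f)).

Lemma key_le_anti : {in E &, antisymmetric key_le}.
Proof.
move=> e f _ _; rewrite /key_le; case: ltngtP => //= _.
by rewrite -eqn_leq => /eqP/val_inj/enum_rank_inj.
Qed.

Lemma key_le_trans : {in E & &, transitive key_le}.
Proof. by move=> f e g _ _ _; rewrite /key_le; lia. Qed.

Lemma key_le_total : {in E &, total key_le}.
Proof. by move=> e f _ _; rewrite /key_le; lia. Qed.

Definition key_graph : eograph V :=
  EOGraph E2 key_le_anti key_le_trans key_le_total.

End KeyOrder.

Section EdgeRank.
Context {V : finType} (H : eograph V).

Definition edge_rank (e : {set V}) : nat :=
  #|[set f in edges H | edge_le H f e]|.

Lemma edge_le_refl : {in edges H, forall e, edge_le H e e}.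
Proof. by move=> e he; have := edge_le_total he he; rewrite orbb. Qed.

Lemma edge_rankE :
  {in edges H &, forall e f, (edge_rank e <= edge_rank f) = edge_le H e f}.
Proof.
move=> e f he hf; apply/idP/idP.
  apply: contraLR => nef; rewrite -ltnNge.
  have fe : edge_le H f e by have := edge_le_total he hf; rewrite (negPf nef).
  apply: proper_card; apply/properP; split.
    apply/fintype.subsetP => g; rewrite !inE => /andP[hg gf].
    by rewrite hg (edge_le_trans hf hg he gf fe).
  by exists e; rewrite !inE he ?edge_le_refl // (negPf nef).
move=> ef; apply: subset_leq_card; apply/fintype.subsetP => g.
by rewrite !inE => /andP[hg ge]; rewrite hg (edge_le_trans he hg hf ge ef).
Qed.

Lemma edge_rank_inj : {in edges H &, injective edge_rank}.
Proof.
move=> e f he hf ef; apply: (edge_le_anti he hf).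
by rewrite -!edge_rankE // ef leqnn.
Qed.

Lemma min_edge_exists : edges H != finset.set0 ->
  exists2 e, e \in edges H & {in edges H, forall f, edge_le H e f}.
Proof.
case/finset.set0Pn => e0 he0; case: (arg_minnP edge_rank he0) => e he emin.
by exists e => // f hf; rewrite -edge_rankE //; exact: emin.
Qed.

End EdgeRank.

(* Greedy completion: any property kept by the addition of a first edge that
   creates no copy of G passes to some saturated graph. *)
Lemma m_saturated_extension (V W : finType) (G : eograph W)
    (P : eograph V -> Prop) :
  (forall H e (he : missing_edge H e),
     P H -> ~ contains (add_first he) G -> P (add_first he)) ->
  forall H : eograph V, P H -> ~ contains H G ->
  exists2 H' : eograph V, m_saturated G H' & P H'.
Proof.
(* Induction on the number of vertex sets that are not edges, which each added edge lowers. *)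
move=> Padd H; have [k] := ubnP (#|{set V}| - #|edges H|).
elim: k H => // k IH H hk PH Hfree.
have [[e [he hfree]]|nex] := pselect (exists e (he : missing_edge H e),
    ~ contains (add_first he) G); last first.
  exists H => //; split=> // e he; apply: contrapT => hc; apply: nex.
  by exists e, he.
apply: (IH _ _ (Padd _ _ he PH hfree) hfree) => /=.
have eH := proj2 he; rewrite cardsU1 eH add1n.
have : #|edges H| < #|{set V}|.
  rewrite -cardsT; apply: proper_card; apply/properP.
  by split; [exact: finset.subsetT | exists e; rewrite ?finset.inE].
by lia.
Qed.

(** * Lower bound: isolated vertices *)

Lemma missing_edge_set2 (V : finType) (H : eograph V) (u w : V) :
  u != w -> [set u; w] \notin edges H -> missing_edge H [set u; w].
Proof. by move=> uw uwH; split=> //; rewrite cards2 uw. Qed.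

Lemma m_saturated_cycle_lower (k : nat) (hk : 2 < k) (C : eograph 'I_k)
    (hC : edges C = cycle_edges k) (V : finType) (H : eograph V) :
  m_saturated C H -> #|V| <= (2 * #|edges H|).+1.
Proof.
move=> [Hfree Hsat]; set U := finset.cover (edges H).
have cardU : #|U| <= 2 * #|edges H|.
  apply: leq_trans (leq_card_cover _) _.
  by rewrite (eq_bigr _ (@edge_card _ H)) sum_nat_const mulnC.
suff : #|~: U| <= 1 by have := cardsC U; lia.
rewrite leqNgt; apply/negP => /card_gt1P[u [w [uU wU uw]]].
have off (f : {set V}) v : v \in ~: U -> v \in f -> f \notin edges H.
  rewrite !inE => vU vf; apply: contra vU => fH.
  by apply/bigcupP; exists f.
have he : missing_edge H [set u; w].
  by apply: missing_edge_set2 => //; apply: off uU _; rewrite !inE eqxx.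
have [phi [phi_inj phi_edge phi_le]] := Hsat _ he.
have cyc i : [set i; ordS i] \in edges C by rewrite hC; apply: imset_f.
(* No edge of [C] maps onto the new edge: the next edge of the cycle would contain an isolated
   vertex of [H], so it would map onto the new edge too, and two consecutive edges of [C] would
   coincide. *)
have old (e : {set 'I_k}) : e \in edges C -> (phi @: e == [set u; w]) = false.
  rewrite {1}hC => /imsetP[i _ ->]; apply/negP => /eqP hi.
  have := phi_edge _ (cyc (ordS i)); rewrite !inE -hi.
  have /negPf-> : phi @: [set ordS i; ordS (ordS i)] \notin edges H.
    apply: (off _ (phi (ordS i))); last by rewrite imset_f // !inE eqxx.
    have : phi (ordS i) \in [set u; w] by rewrite -hi imset_f // !inE eqxx orbT.
    by rewrite in_set2 => /pred2P[->|->].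
  rewrite orbF (inj_eq (imset_inj phi_inj)) => /eqP/setP/(_ i).
  rewrite !inE eqxx /= eq_sym (iter_ordS_neq (m := 1)) /=; last by lia.
  by rewrite eq_sym (iter_ordS_neq (m := 2)) //; lia.
apply: Hfree; exists phi; split=> // [e he'|e f he' hf].
  by have := phi_edge e he'; rewrite !inE old.
by rewrite -phi_le //= /first_le !old.
Qed.

(** * The theta graph and its freeness *)

Section Hub.
Context {k : nat} (hk : 4 < k) (C : eograph 'I_k) (hC : edges C = cycle_edges k).
Context (x : 'I_k) {V : finType} (emb : 'I_k -> V) (emb_inj : injective emb).
Context (xmin : {in edges C, forall e, edge_le C [set x; ordS x] e}).

Definition core : {set 'I_k} := ~: [set x; ordS x].

Definition outer : {set V} := ~: (emb @: core).

(** The candidate copy of [C] that closes the core path through [u] and [w]. By injectivity [emb x]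
    and [emb (ordS x)] are themselves outer vertices. *)
Definition place (u w : V) (i : 'I_k) : V :=
  if i == x then u else if i == ordS x then w else emb i.

Definition path_edges : {set {set 'I_k}} := edges C :\ [set x; ordS x].

Definition trace (f : {set V}) : {set 'I_k} := core :&: emb @^-1: f.

(* A theta graph: the path of C on the core, whose two ends are both joined to
   every outer vertex. *)
Definition hub_edges : {set {set V}} :=
  [set f | [exists u in outer, [exists w in outer, [exists e in path_edges,
     (u != w) && (f == place u w @: e)]]]].

(** The trace on the core determines the path edge that [f] comes from, so the key does not depend
    on [u] and [w]. The default 0 is never reached on hub edges. *)
Definition hub_key (f : {set V}) : nat :=
  if [pick e in path_edges | e :&: core == trace f] is Some e
  then edge_rank C e else 0.

Let ordS_neq m (i : 'I_k) : 0 < m < 5 -> (iter m (@ordS k) i == i) = false.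
Proof. by move=> hm; apply: iter_ordS_neq; lia. Qed.

Let S1 i : (ordS i == i :> 'I_k) = false. Proof. exact: (@ordS_neq 1). Qed.
Let S2 i : (ordS (ordS i) == i :> 'I_k) = false.
Proof. exact: (@ordS_neq 2). Qed.
Let S3 i : (ordS (ordS (ordS i)) == i :> 'I_k) = false.
Proof. exact: (@ordS_neq 3). Qed.
Let S4 i : (ordS (ordS (ordS (ordS i))) == i :> 'I_k) = false.
Proof. exact: (@ordS_neq 4). Qed.

Lemma hub_edgesP (f : {set V}) :
  reflect (exists u w e, [/\ u \in outer, w \in outer, e \in path_edges, u != w
             & f = place u w @: e]) (f \in hub_edges).
Proof.
rewrite inE; apply: (iffP exists_inP) => [[u hu]|[u [w [e [hu hw he uw ->]]]]].
  case/exists_inP=> w hw /exists_inP[e he /andP[uw /eqP->]].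
  by exists u, w, e.
exists u => //; apply/exists_inP; exists w => //; apply/exists_inP; exists e => //.
by rewrite uw eqxx.
Qed.

Lemma path_edgesP (e : {set 'I_k}) :
  e \in path_edges -> exists2 i, i != x & e = [set i; ordS i].
Proof.
rewrite !inE hC => /andP[ne /imsetP[i _ ei]]; exists i => //.
by apply: contra ne => /eqP ix; rewrite ei ix.
Qed.

Lemma path_edgesS (e : {set 'I_k}) : e \in path_edges -> e \in edges C.
Proof. by rewrite !inE => /andP[]. Qed.

Lemma place_core (u w : V) (i : 'I_k) : i \in core -> place u w i = emb i.
Proof. by rewrite !inE negb_or /place => /andP[/negPf-> /negPf->]. Qed.

Lemma emb_core_notin_outer (i : 'I_k) : i \in core -> emb i \notin outer.
Proof. by move=> hi; rewrite !inE negbK imset_f. Qed.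

Lemma place_outer (u w : V) (i : 'I_k) :
  place u w i \in outer -> i = x \/ i = ordS x.
Proof.
have [ic|] := boolP (i \in core); last by rewrite !inE negbK => /pred2P.
by rewrite place_core // (negPf (emb_core_notin_outer ic)).
Qed.

Lemma place_inj (u w : V) : u \in outer -> w \in outer -> u != w ->
  injective (place u w).
Proof.
move=> hu hw uw.
have px : place u w x = u by rewrite /place eqxx.
have py : place u w (ordS x) = w by rewrite /place S1 eqxx.
have key i j : place u w i = place u w j -> i \notin core -> i = j.
  move=> ij; rewrite !inE negbK => /pred2P[] ei; move: ij; rewrite ei ?px ?py.
    move=> uj; have : place u w j \in outer by rewrite -uj.
    by move/place_outer => [] // ej; move: uj uw; rewrite ej py => ->; rewrite eqxx.
  move=> wj; have : place u w j \in outer by rewrite -wj.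
  by move/place_outer => [] // ej; move: wj uw; rewrite ej px => ->; rewrite eqxx.
move=> i j ij.
have [ic|] := boolP (i \in core); last exact: key.
have [jc|jc] := boolP (j \in core); last by rewrite (key j i).
by move: ij; rewrite !place_core // => /emb_inj.
Qed.

Lemma trace_place (u w : V) (e : {set 'I_k}) : u \in outer -> w \in outer ->
  u != w -> trace (place u w @: e) = e :&: core.
Proof.
move=> hu hw uw; apply/setP => i; rewrite !finset.in_setI.
have [ic|_] := boolP (i \in core); rewrite ?andbF // andbT finset.inE.
by rewrite -(place_core u w ic) mem_imset //; exact: place_inj.
Qed.

(** Inner path edges lie in the core. The two end edges meet it in one vertex each, [ord_pred x] and
    [ordS (ordS x)], and these differ because [k] is not 3. *)
Lemma path_edge_core_inj :
  {in path_edges &, injective (fun e : {set 'I_k} => e :&: core)}.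
Proof.
have key i j : i != x -> j != x -> i \in core ->
    [set i; ordS i] :&: core = [set j; ordS j] :&: core -> i = j.
  move=> ix jx ic /setP E.
  have := E i; rewrite !finset.in_setI ic !andbT !in_set2 eqxx /=.
  case/esym/pred2P=> // iSj.
  have [Sic|] := boolP (ordS i \in core).
    have := E (ordS i); rewrite !finset.in_setI Sic !andbT !in_set2 eqxx orbT.
    by case/esym/pred2P=> [|/ordS_inj //]; rewrite iSj => /eqP; rewrite S2.
  rewrite !inE negbK => /pred2P[Six|/ordS_inj]; last first.
    by move/eqP; rewrite (negPf ix).
  have [jc|] := boolP (j \in core).
    have := E j; rewrite !finset.in_setI jc !andbT !in_set2 eqxx /=.
    case/pred2P=> // jSi; move: (S2 j); rewrite -iSj -jSi eqxx //.
  rewrite !inE negbK (negPf jx) /= => /eqP jy.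
  by move: (S3 x); rewrite -jy -iSj Six eqxx.
move=> e f /path_edgesP[i ix ->] /path_edgesP[j jx ->] /= E.
suff -> : i = j by [].
have [ic|] := boolP (i \in core); first exact: key.
have [jc|] := boolP (j \in core); first by rewrite (key j i).
by rewrite !inE !negbK (negPf ix) (negPf jx) /= => /eqP-> /eqP->.
Qed.

Lemma hub_key_place (u w : V) (e : {set 'I_k}) : u \in outer -> w \in outer ->
  u != w -> e \in path_edges -> hub_key (place u w @: e) = edge_rank C e.
Proof.
move=> hu hw uw he; rewrite /hub_key trace_place //.
case: pickP => [f /andP[hf /eqP fe]|/(_ e)].
  by rewrite (path_edge_core_inj hf he fe).
by rewrite he eqxx.
Qed.

Lemma hub_edges_card : {in hub_edges, forall f : {set V}, #|f| = 2}.
Proof.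
move=> f /hub_edgesP[u [w [e [hu hw he uw ->]]]].
by rewrite card_imset; [exact: (edge_card (path_edgesS he)) | exact: place_inj].
Qed.

Definition hub_graph : eograph V := key_graph hub_edges_card hub_key.

(** The outer end of a hub edge comes from [x] or [ordS x]; as the edge between these two is
    removed, the other end is an end of the core path. *)
Lemma hub_nbr (v z : V) : v \in outer -> [set v; z] \in hub_edges ->
  z = emb (ord_pred x) \/ z = emb (ordS (ordS x)).
Proof.
move=> hv vz; have := hub_edges_card vz; rewrite cards2.
case/hub_edgesP: vz => u [w [e [hu hw /path_edgesP[i ix ->] uw]]].
rewrite imset_set2 => E; case: eqVneq => // vneqz _.
have : v \in [set place u w i; place u w (ordS i)] by rewrite -E !inE eqxx.
have : z \in [set place u w i; place u w (ordS i)] by rewrite -E !inE eqxx orbT.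
rewrite !in_set2 => /pred2P[] zE /pred2P[] vE.
- by rewrite zE vE eqxx in vneqz.
- left; rewrite vE in hv; case: (place_outer hv) => [Six|/ordS_inj/eqP].
    have -> : ord_pred x = i by rewrite -Six ordSK.
    by rewrite zE place_core // !inE (negPf ix) /= -Six eq_sym S2.
  by rewrite (negPf ix).
- right; rewrite vE in hv; case: (place_outer hv) => [/eqP|iy].
    by rewrite (negPf ix).
  by rewrite zE iy place_core // !inE S1 S2.
- by rewrite zE vE eqxx in vneqz.
Qed.

(* Two vertices of a copy of C are outer; both have the two ends of the core
   path as their neighbours on the copy, which closes a 4-cycle. *)
Lemma hub_graph_free : ~ contains hub_graph C.
Proof.
move=> [phi [phi_inj phi_edge _]].
have adj i : [set phi i; phi (ordS i)] \in hub_edges.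
  by rewrite -imset_set2; apply: phi_edge; rewrite hC; apply: imset_f.
set D := [set i | phi i \in outer].
(* The copy has [k] vertices, and those that are not outer inject into the [k - 2] core vertices. *)
have cD : #|~: D| <= #|core|.
  rewrite -(card_imset _ phi_inj); apply: leq_trans (leq_imset_card emb _).
  apply: subset_leq_card; apply/fintype.subsetP => v /imsetP[i].
  by rewrite !inE negbK => hi ->.
have : 1 < #|D|.
  have := cardsC D; have := cardsC [set x; ordS x].
  rewrite card_ord cards2 eq_sym S1 /= => cC cDk.
  by rewrite -(ltn_add2r #|~: D|) cDk -[ltnRHS]cC add1n add2n ltnS.
case/card_gt1P=> i [j [hi hj ij]].
have nbr i' : i' \in D -> exists2 a, i' = ordS a &
    (phi a = emb (ord_pred x) \/ phi a = emb (ordS (ordS x))) /\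
    (phi (ordS i') = emb (ord_pred x) \/ phi (ordS i') = emb (ordS (ordS x))).
  rewrite inE => hi'; exists (ord_pred i'); first by rewrite ord_predK.
  split; apply: hub_nbr hi' _; last exact: adj.
  by rewrite finset.setUC -{2}(ord_predK i') adj.
have [a ia [a1 a2]] := nbr _ hi; have [b jb [b1 b2]] := nbr _ hj.
have ab : a <> b by move=> ab; rewrite ia jb ab eqxx in ij.
rewrite ia in a2; rewrite jb in b2.
(* [phi c] and [phi d] exhaust the two ends of the core path, so [phi (ordS (ordS d))], being an end
   other than [phi d], equals [phi c]. *)
have far c d : c <> d ->
    phi c = emb (ord_pred x) \/ phi c = emb (ordS (ordS x)) ->
    phi d = emb (ord_pred x) \/ phi d = emb (ordS (ordS x)) ->
    phi (ordS (ordS d)) = emb (ord_pred x) \/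
    phi (ordS (ordS d)) = emb (ordS (ordS x)) ->
    c = ordS (ordS d).
  move=> cd hc hd hdd.
  have cd' : phi c <> phi d by move/phi_inj.
  have dd : phi (ordS (ordS d)) <> phi d by move/phi_inj/eqP; rewrite S2.
  by apply: phi_inj; case: hc hd hdd => p [] q [] r; move: cd' dd; rewrite ?p ?q ?r.
(* Now [a] is two steps after [b] and [b] two steps after [a], so four steps close up, which [k > 4]
   excludes. *)
have abS := far _ _ ab a1 b1 b2; have /eqP := far _ _ (nesym ab) b1 a1 a2.
by rewrite abS eq_sym S4.
Qed.

(** * Completion keeps the hub structure *)

(** The invariant of the greedy completion. The order is prescribed only among the edges of one path
    [place u w], since closing that path to a copy of [C] compares no others. *)
Definition hub_like (H : eograph V) : Prop :=
  [/\ {in outer &, forall u w, u != w ->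
        {in path_edges, forall e : {set 'I_k}, place u w @: e \in edges H}},
      {in outer &, forall u w, u != w -> {in path_edges &, forall e f : {set 'I_k},
        edge_le H (place u w @: e) (place u w @: f) = edge_le C e f}} &
      {in outer &, forall u w, [set u; w] \notin edges H}].

(** Along one path the keys are the ranks in [C], which are distinct, so the tie-break never
    separates two different edges. *)
Lemma hub_graph_like : hub_like hub_graph.
Proof.
split=> [u w hu hw uw e he|u w hu hw uw e f he hf|u w hu hw].
- by apply/hub_edgesP; exists u, w, e.
- rewrite /= /key_le !hub_key_place // -edge_rankE ?path_edgesS //.
  case: ltngtP => //= ef.
  by rewrite (edge_rank_inj (path_edgesS he) (path_edgesS hf) ef) leqnn.
apply/negP => /(hub_nbr hu)[] wE; move: hw; rewrite wE; apply/negP.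
  apply: emb_core_notin_outer; rewrite !inE negb_or -(inj_eq (@ordS_inj k)).
  rewrite ord_predK eq_sym S1 /= -(inj_eq (@ordS_inj k)) ord_predK eq_sym.
  by rewrite S2.
by apply: emb_core_notin_outer; rewrite !inE S1 S2.
Qed.

(** The new smallest edge plays the role of the smallest edge of [C], and [place u w] is the
    copy. *)
Lemma hub_like_contains (H : eograph V) (u w : V)
    (he : missing_edge H [set u; w]) :
  hub_like H -> u \in outer -> w \in outer -> u != w ->
  contains (add_first he) C.
Proof.
move=> [H1 H2 _] hu hw uw; exists (place u w).
have inj := place_inj hu hw uw.
have uwE : [set u; w] = place u w @: [set x; ordS x].
  by rewrite imset_set2 /place eqxx S1 eqxx.
have x0 : [set x; ordS x] \in edges C by rewrite hC; apply: imset_f.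
have newE (f : {set 'I_k}) : (place u w @: f == [set u; w]) = (f == [set x; ordS x]).
  by rewrite uwE (inj_eq (imset_inj inj)).
split=> // [f hf|f g hf hg].
  rewrite !inE newE; have [//|fx] := eqVneq f _.
  by rewrite H1 // !inE fx.
rewrite /= /first_le !newE.
have [->|fx] := eqVneq f _; first by rewrite xmin.
have [->|gx] /= := eqVneq g _; last by rewrite H2 // !inE ?fx ?gx.
apply/esym/negP => fx'; move/negP: fx; apply; apply/eqP.
by apply: (edge_le_anti hf x0); rewrite fx' xmin.
Qed.

(** An edge between two outer vertices would create a copy of [C]; any other new edge leaves the old
    comparisons intact. *)
Lemma hub_like_add_first (H : eograph V) (e : {set V}) (he : missing_edge H e) :
  hub_like H -> ~ contains (add_first he) C -> hub_like (add_first he).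
Proof.
move=> hH; have [H1 H2 H3] := hH; have [e2 eH] := he => hfree.
have old u w (f : {set 'I_k}) : u \in outer -> w \in outer -> u != w -> f \in path_edges ->
    (place u w @: f == e) = false.
  by move=> hu hw uw hf; apply: contraNF eH => /eqP <-; exact: H1.
split=> [u w hu hw uw f hf|u w hu hw uw f g hf hg|u w hu hw].
- by rewrite !inE H1 ?orbT.
- by rewrite /= /first_le !old // H2.
rewrite !inE negb_or H3 // andbT; apply/eqP => uwe; subst e.
apply: hfree; apply: hub_like_contains => //.
by move: e2; rewrite cards2; case: (u != w).
Qed.

(** Every edge meets the core, so it is the image of a pair of an index in ['I_k] and a vertex. *)
Lemma hub_like_card (H : eograph V) : hub_like H -> #|edges H| <= k * #|V|.
Proof.
move=> [_ _ H3].
pose pair (p : 'I_k * V) := [set emb p.1; p.2].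
have <- : #|{: 'I_k * V}| = k * #|V| by rewrite card_prod card_ord.
apply: leq_trans (leq_imset_card pair _); apply: subset_leq_card.
apply/fintype.subsetP => e he; have /eqP/cards2P[u [w [uw eE]]] := edge_card he.
have coreP v : v \notin outer -> exists i, v = emb i.
  by rewrite !inE negbK => /imsetP[i _ ->]; exists i.
have [hu|/coreP[i ui]] := boolP (u \in outer); last first.
  by apply/imsetP; exists (i, w); rewrite // /pair /= -ui.
have [hw|/coreP[i wi]] := boolP (w \in outer).
  by move: (H3 _ _ hu hw); rewrite -eE he.
by apply/imsetP; exists (i, u); rewrite // /pair /= -wi finset.setUC.
Qed.

End Hub.

(** * Upper bound and the asymptotic estimate *)

Lemma m_saturated_cycle_upper (k : nat) (hk : 4 < k) (C : eograph 'I_k)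
    (hC : edges C = cycle_edges k) (V : finType) (hV : k <= #|V|) :
  exists2 H : eograph V, m_saturated C H & #|edges H| <= k * #|V|.
Proof.
have i0 : 'I_k by apply: (@Ordinal k 0); lia.
have C0 : edges C != finset.set0.
  by apply/finset.set0Pn; exists [set i0; ordS i0]; rewrite hC; apply: imset_f.
(* [x] is the vertex at which the smallest edge of [C] starts. *)
have [e] := min_edge_exists C0; rewrite {1}hC => /imsetP[x _ ->] xmin.
pose emb (i : 'I_k) : V := enum_val (widen_ord hV i).
have emb_inj : injective emb.
  by move=> i j /enum_val_inj /(congr1 val) ij; apply: val_inj.
have [H Hsat Hhub] := m_saturated_extension
  (hub_like_add_first hk hC emb_inj xmin)
  (hub_graph_like hk hC x emb_inj) (@hub_graph_free _ hk _ hC _ _ _ emb_inj).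
by exists H => //; exact: (hub_like_card Hhub).
Qed.

Local Open Scope classical_set_scope.
Local Open Scope ring_scope.

Theorem claim30 (R : realType) (k : nat) (hk : (5 <= k)%N)
    (C : eograph 'I_k) (hC : edges C = cycle_edges k) :
  (fun n : nat => (sat_m n C)%:R : R^o) =Theta_\oo (fun n : nat => n%:R : R^o).
Proof.
have C0 : edges C != finset.set0.
  apply/finset.set0Pn; have i0 : 'I_k by apply: (@Ordinal k 0); lia.
  by exists [set i0; ordS i0]%SET; rewrite hC; apply: imset_f.
(* With [m] edges the lower bound is [n <= 2 * m + 1]. For [n >= 5] it forces [m >= 1], hence
   [n <= 4 * m]; this gives the constant 1/4. *)
rewrite eqThetaE qualifE; apply/asboolP; exists (4^-1, k%:R).
  by rewrite /= invr_gt0 !ltr0n; apply/andP; split=> //; lia.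
near=> n; rewrite /= !ger0_norm ?ler0n //.
have kn : (k <= n)%N by near: n; exact: nbhs_infty_ge.
have [[H [Hsat Hm]] satmin] := sat_mP C0 n.
split.
  have : (2 < k)%N by lia.
  move=> /m_saturated_cycle_lower /(_ _ hC _ _ Hsat); rewrite card_ord Hm => hn.
  by rewrite mulrC ler_pdivrMr ?ltr0n // -natrM ler_nat; lia.
have [H' H'sat] : exists2 H : eograph 'I_n, m_saturated C H &
    (#|edges H| <= k * #|{: 'I_n}|)%N.
  by apply: m_saturated_cycle_upper; rewrite ?card_ord.
rewrite card_ord -natrM ler_nat; apply: leq_trans; exact: satmin.
Unshelve. all: by end_near. Qed.
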